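(* Let $\mathcal{Q}=(Q,\&)$ be a quantale. The class $\mathcal{I}$ of irreducible ideals is saturated; that is, for every $\mathcal{Q}$-ordered set $A$ and every irreducible ideal $\Lambda$ of the $\mathcal{Q}$-ordered set $\mathcal{I}(A)$, the map $\bigvee_{\phi\in\mathcal{I}(A)}\Lambda(\phi)\&\phi : A\to Q$ is an irreducible ideal of $A$.
   Context: A quantale $\mathcal{Q}=(Q,\&)$ is always assumed integral and commutative: $Q$ is a complete lattice (bottom $0$, top $1$) and $\&$ is a commutative associative operation on $Q$ with unit $1$ that distributes over arbitrary joins. Its implication $\to$ is defined by $p\&q\le r\iff q\le p\to r$. A $\mathcal{Q}$-ordered set is a set $A$ with a map $A(-,-):A\times A\to Q$ such that $A(x,x)=1$ and $A(y,z)\&A(x,y)\le A(x,z)$ for all $x,y,z\in A$. A fuzzy lower set of $A$ is a map $\phi:A\to Q$ with $\phi(y)\&A(x,y)\le\phi(x)$ for all $x,y$. Joins of maps $A\to Q$ are pointwise and $(p\&\phi)(x)=p\&\phi(x)$. For fuzzy lower sets, $\mathrm{sub}_A(\phi_1,\phi_2)=\bigwedge_{x\in A}(\phi_1(x)\to\phi_2(x))$. A map $\lambda:A\to Q$ is inhabited if $\bigvee_{a\in A}\lambda(a)=1$. A fuzzy lower set $\phi$ of $A$ is an irreducible ideal if it is inhabited and $\mathrm{sub}_A(\phi,\phi_1\vee\phi_2)=\mathrm{sub}_A(\phi,\phi_1)\vee\mathrm{sub}_A(\phi,\phi_2)$ for all fuzzy lower sets $\phi_1,\phi_2$ of $A$.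 $\mathcal{I}(A)$ denotes the set of irreducible ideals of $A$, made into a $\mathcal{Q}$-ordered set by $\mathrm{sub}_A$. In general, a class of weights $\Phi$ (assigning to each $A$ a set $\Phi(A)$ of fuzzy lower sets of $A$, $\mathcal{Q}$-ordered by $\mathrm{sub}_A$) is saturated if $\bigvee_{\phi\in\Phi(A)}\Lambda(\phi)\&\phi\in\Phi(A)$ for all $A$ and all $\Lambda\in\Phi(\Phi(A))$. *)

(* Defs.v *)
From HB Require Import structures.
From mathcomp Require Import all_boot all_order.
From mathcomp Require Import boolp classical_sets.

Set Implicit Arguments.
Unset Strict Implicit.
Unset Printing Implicit Defensive.

Import Order.TTheory.
Local Open Scope classical_set_scope.
Local Open Scope order_scope.

HB.mixin Record hasBigJoin d T of Order.TBLattice d T := {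
  bigjoin : set T -> T;
  bigjoinP : forall S : set T, supremums S (bigjoin S)
}.

#[short(type="completeLatticeType")]
HB.structure Definition CompleteLattice d :=
  {T of Order.TBLattice d T & hasBigJoin d T}.

Definition bigmeet d (T : completeLatticeType d) (S : set T) : T :=
  bigjoin (lbound S).

Lemma bigmeetP d (T : completeLatticeType d) (S : set T) :
  infimums S (bigmeet S).
Proof.
have [ub lub] := bigjoinP (lbound S); split=> [x Sx|]; last exact: ub.
by apply: lub => y; apply.
Qed.

(* Commutative and integral: the unit of the multiplication is \top. *)
HB.mixin Record isQuantale d Q of CompleteLattice d Q := {
  qmul : Q -> Q -> Q;
  qmulA : associative qmul;
  qmulC : commutative qmul;
  qmul1 : left_id (\top : Q) qmul;
  qmul_bigjoin : forall (p : Q) (S : set Q),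
    qmul p (bigjoin S) = bigjoin [set qmul p q | q in S]
}.

#[short(type="quantaleType")]
HB.structure Definition Quantale d :=
  {Q of CompleteLattice d Q & isQuantale d Q}.

Notation "p \& q" := (qmul p q) (at level 40, left associativity).

Section QuantaleTheory.
Context d (Q : quantaleType d).
Implicit Types p q r : Q.

Definition qimp p r : Q := bigjoin [set q | p \& q <= r].

Lemma qmulr p : p \& \top = p.
Proof. by rewrite qmulC qmul1. Qed.

Lemma le_qmul2l p q r : q <= r -> p \& q <= p \& r.
Proof.
move=> qr; have [ub lub] := bigjoinP [set q; r].
have -> : r = bigjoin [set q; r].
  apply/le_anti/andP; split; first by apply: ub; right.
  by apply: lub => x [->|->].
rewrite qmul_bigjoin; apply: (bigjoinP _).1.
by exists q => //; left.
Qed.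

Lemma qimpP p q r : (p \& q <= r) <-> (q <= qimp p r).
Proof.
split=> [pq|qpr]; first exact: (bigjoinP _).1.
apply: le_trans (le_qmul2l p qpr) _.
rewrite qmul_bigjoin; apply: (bigjoinP _).2.
by move=> _ [s /= ps <-].
Qed.

(* No separatedness (antisymmetry) is required. *)
Record qorder := QOrder {
  qcarrier :> Type;
  qhom : qcarrier -> qcarrier -> Q;
  qhom_refl : forall x, qhom x x = \top;
  qhom_trans : forall x y z, qhom y z \& qhom x y <= qhom x z
}.

Definition fuzzy_lower (A : qorder) : set (A -> Q) :=
  [set phi | forall x y, phi y \& qhom x y <= phi x].

Definition fuzzy_sub (A : Type) (phi1 phi2 : A -> Q) : Q :=
  bigmeet (range (fun x => qimp (phi1 x) (phi2 x))).

Definition inhabited_map (A : Type) (lambda : A -> Q) : Prop :=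
  bigjoin (range lambda) = \top.

Lemma fuzzy_subP (A : Type) (phi1 phi2 : A -> Q) p :
  (forall x, phi1 x \& p <= phi2 x) <-> (p <= fuzzy_sub phi1 phi2).
Proof.
split=> [h|h x].
  by apply: (bigmeetP _).2 => _ [x _ <-]; apply/qimpP.
apply/qimpP; apply: le_trans h _.
by apply: (bigmeetP _).1; exists x.
Qed.

Lemma fuzzy_sub_refl (A : Type) (phi : A -> Q) : fuzzy_sub phi phi = \top.
Proof.
by apply/le_anti; rewrite lex1; apply/fuzzy_subP => x; rewrite qmulr.
Qed.

Lemma fuzzy_sub_trans (A : Type) (phi1 phi2 phi3 : A -> Q) :
  fuzzy_sub phi2 phi3 \& fuzzy_sub phi1 phi2 <= fuzzy_sub phi1 phi3.
Proof.
have subP (psi1 psi2 : A -> Q) x : psi1 x \& fuzzy_sub psi1 psi2 <= psi2 x.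
  exact: (fuzzy_subP psi1 psi2 _).2.
apply/fuzzy_subP => x; rewrite (qmulC (fuzzy_sub _ _)) qmulA qmulC.
apply: le_trans (le_qmul2l _ (subP phi1 phi2 x)) _.
by rewrite qmulC.
Qed.

Definition fuzzy_qorder (A : Type) (F : set (A -> Q)) : qorder :=
  @QOrder F (fun phi1 phi2 => fuzzy_sub (val phi1) (val phi2))
    (fun phi => fuzzy_sub_refl (val phi))
    (fun phi1 phi2 phi3 => fuzzy_sub_trans (val phi1) (val phi2) (val phi3)).

Record weight_class := WeightClass {
  weights :> forall A : qorder, set (A -> Q);
  weights_lower : forall A : qorder, @weights A `<=` @fuzzy_lower A
}.

Arguments weights Phi A : rename.

Definition saturated (Phi : weight_class) : Prop :=
  forall (A : qorder) (Lambda : fuzzy_qorder (Phi A) -> Q),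
    Phi (fuzzy_qorder (Phi A)) Lambda ->
    Phi A (fun x => bigjoin
      (range (fun phi : fuzzy_qorder (Phi A) => Lambda phi \& val phi x))).

Definition irreducible_ideal (A : qorder) : set (A -> Q) :=
  [set phi | [/\ fuzzy_lower phi, inhabited_map phi &
    forall phi1 phi2 : A -> Q, fuzzy_lower phi1 -> fuzzy_lower phi2 ->
      fuzzy_sub phi (fun x => phi1 x `|` phi2 x) =
      fuzzy_sub phi phi1 `|` fuzzy_sub phi phi2]].

Lemma irreducible_ideal_lower (A : qorder) :
  @irreducible_ideal A `<=` @fuzzy_lower A.
Proof. by move=> phi []. Qed.

Definition irreducible_ideals : weight_class :=
  WeightClass irreducible_ideal_lower.

End QuantaleTheory.

Arguments irreducible_ideals {d} Q.

(* Main.v *)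
Require Import Defs.
From mathcomp Require Import all_boot all_order.
From mathcomp Require Import boolp classical_sets.

(** Write [s] for the weighted join of all irreducible ideals [phi] with
    weights [Lambda phi].  The implication turns joins in its first argument
    into meets, so [s] has the universal property of a colimit weighted by
    [Lambda] ([fuzzy_sub_weighted_join]): the degree to which [s] is below
    [psi] is the degree to which [Lambda] is below the map
    [phi |-> fuzzy_sub phi psi].  That map is itself a fuzzy lower set of the
    ordered set of ideals, by transitivity of [fuzzy_sub].  Hence
    irreducibility of each [phi] splits [fuzzy_sub phi (psi1 \/ psi2)] into a
    join of two such lower sets, and irreducibility of [Lambda] then splits the
    outer [fuzzy_sub].  Inhabitedness passes from [Lambda] and the [phi] to [s]
    because the multiplication distributes over joins. *)

Set Implicit Arguments.
Unset Strict Implicit.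
Unset Printing Implicit Defensive.

Import Order.TTheory.
Local Open Scope classical_set_scope.
Local Open Scope order_scope.

Section WeightedJoin.
Context d (Q : quantaleType d).
Implicit Types (p q r : Q) (A B : Type).

Lemma bigjoin_range_leP B (f : B -> Q) r :
  (forall b, f b <= r) <-> bigjoin (range f) <= r.
Proof.
split=> [fr|fr b]; first by apply: (bigjoinP _).2 => _ [b _ <-].
by apply: le_trans fr; apply: (bigjoinP _).1; exists b.
Qed.

Lemma qmul_bigjoin_range B p (f : B -> Q) :
  p \& bigjoin (range f) = bigjoin (range (fun b => p \& f b)).
Proof. by rewrite qmul_bigjoin image_comp. Qed.

Definition weighted_join A B (F : B -> A -> Q) (lambda : B -> Q) : A -> Q :=
  fun x => bigjoin (range (fun b => lambda b \& F b x)).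

Lemma le_weighted_join A B (F : B -> A -> Q) (lambda : B -> Q) b x :
  lambda b \& F b x <= weighted_join F lambda x.
Proof. exact: ((bigjoin_range_leP _ _).2 (lexx _) b). Qed.

(** Both sides have the same lower bounds: [p] lies below either of them iff
    [F b x \& (lambda b \& p) <= psi x] for all [b] and [x]. *)
Lemma fuzzy_sub_weighted_join A B (F : B -> A -> Q) (lambda : B -> Q)
    (psi : A -> Q) :
  fuzzy_sub (weighted_join F lambda) psi =
  fuzzy_sub lambda (fun b => fuzzy_sub (F b) psi).
Proof.
apply/le_anti/andP; split; apply/fuzzy_subP; [move=> b | move=> x].
  apply/fuzzy_subP => x; rewrite qmulA (qmulC (F b x)) qmulC.
  apply: le_trans (le_qmul2l _ (le_weighted_join F lambda b x)) _.
  by rewrite qmulC; apply: (fuzzy_subP _ _ _).2.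
rewrite qmulC qmul_bigjoin_range; apply/bigjoin_range_leP => b.
rewrite qmulC (qmulC (lambda b)) -qmulA.
by apply: (fuzzy_subP _ _ _).2 x; move: b; apply/fuzzy_subP.
Qed.

Lemma fuzzy_lower_weighted_join (A : qorder Q) B (F : B -> A -> Q)
    (lambda : B -> Q) :
  (forall b, fuzzy_lower (F b)) -> fuzzy_lower (weighted_join F lambda).
Proof.
move=> lowF x y; rewrite qmulC qmul_bigjoin_range.
apply/bigjoin_range_leP => b; apply: le_trans (le_weighted_join F lambda b x).
by rewrite qmulC -qmulA; apply: le_qmul2l; apply: lowF.
Qed.

Lemma inhabited_weighted_join A B (F : B -> A -> Q) (lambda : B -> Q) :
  (forall b, inhabited_map (F b)) -> inhabited_map lambda ->
  inhabited_map (weighted_join F lambda).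
Proof.
move=> inhF inh; apply/le_anti; rewrite lex1 /= -{1}inh.
apply/bigjoin_range_leP => b.
rewrite -[lambda b]qmulr -(inhF b) qmul_bigjoin_range.
apply/bigjoin_range_leP => x; apply: le_trans (le_weighted_join F lambda b x) _.
exact: ((bigjoin_range_leP _ _).2 (lexx _) x).
Qed.

Lemma fuzzy_lower_sub A (F : set (A -> Q)) (psi : A -> Q) :
  fuzzy_lower (fun phi : fuzzy_qorder F => fuzzy_sub (val phi) psi).
Proof. by move=> phi1 phi2; apply: fuzzy_sub_trans. Qed.

End WeightedJoin.

Theorem proposition4p4 (d : Order.disp_t) (Q : quantaleType d) :
  saturated (irreducible_ideals Q).
Proof.
move=> A Lambda [_ inhL irrL].
have idealP (phi : fuzzy_qorder (irreducible_ideals Q A)) :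
    irreducible_ideal (val phi) by exact: set_valP.
rewrite -[X in _ X]/(weighted_join (fun phi => val phi) Lambda).
split.
- by apply: fuzzy_lower_weighted_join => phi; case: (idealP phi).
- by apply: inhabited_weighted_join inhL => phi; case: (idealP phi).
move=> psi1 psi2 low1 low2; rewrite !fuzzy_sub_weighted_join.
rewrite -irrL; [|exact: fuzzy_lower_sub..].
congr fuzzy_sub; apply/funext => phi.
by have [_ _ irr] := idealP phi; apply: irr.
Qed.
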